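(* Let $(a_n)_{n=0}^{\infty}$ be a Leja sequence on the unit circle $S^1$, and let $P_N(z)=\prod_{k=0}^{N-1}(z-a_k)$ and $\|P_N\|=\sup_{z\in S^1}|P_N(z)|$. For all $N\geq 1$ we have $$0<\frac{\log\|P_N\|}{\log(N+1)}\leq 1.$$ The upper bound is attained if and only if $N$ is of the form $N=2^m-1$ with $m\geq 1$ an integer, and we have $$\liminf_{N\to\infty}\frac{\log\|P_N\|}{\log(N+1)}=0.$$ Moreover, for each fixed integer $N\geq 1$, the sequence $$\left(\frac{\log\|P_{2^kN}\|}{\log(2^kN+1)}\right)_{k=0}^{\infty}$$ is decreasing and its limit is $0$.
   Context: $S^1=\{z\in\mathbb{C}:|z|=1\}$. A sequence $(a_n)_{n=0}^{\infty}\subset S^1$ is called a Leja sequence on $S^1$ if for every $n\geq 1$, $\prod_{k=0}^{n-1}|a_n-a_k|=\max_{z\in S^1}\prod_{k=0}^{n-1}|z-a_k|$ (the initial point $a_0\in S^1$ is arbitrary). *)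

(* Defs.v *)
From HB Require Import structures.
From mathcomp Require Export all_boot all_order all_algebra.
From mathcomp Require Export complex.
From mathcomp Require Export all_classical all_reals all_analysis.

Set Implicit Arguments.
Unset Strict Implicit.
Unset Printing Implicit Defensive.

Import Order.TTheory GRing.Theory Num.Theory.
Import numFieldNormedType.Exports.

Local Open Scope classical_set_scope.
Local Open Scope ring_scope.

(* On R[i] the norm `|z| takes its values in R[i], whereas Normc.normc is the
   same modulus with values in R. *)
Definition unit_circle (R : realType) : set R[i] :=
  [set z | Normc.normc z = 1].

(* Since a n itself lies on the circle, the last clause says that the maximum
   over the circle exists and is attained at a n. *)
Definition leja_on_circle (R : realType) (a : nat -> R[i]) : Prop :=
  (forall n, unit_circle (a n)) /\
  (forall n, (1 <= n)%N -> forall z, unit_circle z ->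
     \prod_(k < n) Normc.normc (z - a k)
       <= \prod_(k < n) Normc.normc (a n - a k)).

Definition leja_poly (R : realType) (a : nat -> R[i]) (N : nat) : {poly R[i]} :=
  \prod_(k < N) ('X - (a k)%:P).

Definition circle_norm (R : realType) (p : {poly R[i]}) : R :=
  sup [set Normc.normc p.[z] | z in @unit_circle R].

Definition log_ratio (R : realType) (a : nat -> R[i]) (N : nat) : R :=
  ln (circle_norm (leja_poly a N)) / ln (N.+1%:R).

(* Main.v *)
Require Import Defs.
From mathcomp Require Import ring lra zify.

Set Implicit Arguments.
Unset Strict Implicit.
Unset Printing Implicit Defensive.

Import Order.TTheory GRing.Theory Num.Theory.
Import numFieldNormedType.Exports.

Local Open Scope classical_set_scope.
Local Open Scope ring_scope.

(** The whole statement follows from the exact value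
    [‖P_N‖ = 2 ^ s], where [s] is the number of ones in the binary expansion
    of [N].  Indeed [2 ^ s <= N + 1], with equality exactly when all digits of
    [N] are ones, and [s] does not change when [N] is multiplied by a power
    of two: along [2 ^ k * N] the numerator of the ratio is constant and
    positive while the denominator increases to infinity.

    The value is computed by passing from [N] to [N / 2].  The odd-indexed
    points are antipodal to their predecessors: if this holds up to index
    [2k], then [P_{2k}(z)] is a polynomial in [z ^ 2], so its modulus is
    maximal at [- a_{2k}] as well as at [a_{2k}]; and [- a_{2k}] is the only
    point of the circle at the maximal distance 2 from [a_{2k}].  Hence
    [- a_{2k}] maximizes both factors of [P_{2k+1}], and any other maximizer
    of the product must do the same ([leja_antipodal]).  Consequently
    [P_{2k}(z) = Q_k(z ^ 2)], where [Q_k] is the nodal polynomial of the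
    points [a_0 ^ 2, a_2 ^ 2, ...].  Squaring maps the circle onto itself, so
    these points form a Leja sequence again ([leja_square_evens]), and
    [‖P_{2k}‖ = ‖Q_k‖], [‖P_{2k+1}‖ = 2 ‖Q_k‖].  As these recursions
    change the sequence, the induction is over all Leja sequences at once
    ([leja_nodal_max]). *)

(** * The number of ones in a binary expansion *)

Lemma double_ind (P : nat -> Prop) :
    P 0%N -> (forall k, (0 < k)%N -> P k -> P k.*2) ->
    (forall k, P k -> P k.*2.+1) ->
  forall n, P n.
Proof.
move=> P0 Pdouble PdoubleS; elim/ltn_ind => n IHn.
rewrite -(odd_double_half n); case: (boolP (odd n)) => odd_n.
  by apply: PdoubleS; apply: IHn; lia.
case: (posnP n./2) => [-> //|half_gt0].
by apply: Pdouble => //; apply: IHn; lia.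
Qed.

(** The range is a crude bound on the number of digits that avoids a
    logarithm; it suffices because [n < 2 ^ n]. *)
Definition binary_ones (n : nat) : nat := (\sum_(i < n) odd (n %/ 2 ^ i))%N.

Lemma binary_ones_widen (n B : nat) : (n <= B)%N ->
  (\sum_(i < B) odd (n %/ 2 ^ i))%N = binary_ones n.
Proof.
move=> le_nB; rewrite /binary_ones.
have high_bit i : (n <= i)%N -> (n %/ 2 ^ i)%N = 0%N.
  by move=> le_ni; apply/divn_small/(leq_ltn_trans le_ni)/ltn_expl.
rewrite (big_ord_widen B (fun i => nat_of_bool (odd (n %/ 2 ^ i))) le_nB).
rewrite [RHS]big_mkcond; apply: eq_bigr => i _.
by case: ifPn => //; rewrite -leqNgt => /high_bit ->.
Qed.

Lemma binary_ones_half (n : nat) :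
  binary_ones n = (odd n + binary_ones n./2)%N.
Proof.
case: n => [|n]; first by rewrite /binary_ones !big_ord0.
rewrite -(@binary_ones_widen n.+1./2 n); last by lia.
rewrite {1}/binary_ones big_ord_recl expn0 divn1; congr addn.
by apply: eq_bigr => i _; rewrite -divn2 -divnMA -expnS.
Qed.

Lemma binary_ones_double (n : nat) : binary_ones n.*2 = binary_ones n.
Proof. by rewrite binary_ones_half odd_double doubleK. Qed.

Lemma binary_ones_doubleS (n : nat) :
  binary_ones n.*2.+1 = (binary_ones n).+1.
Proof. by rewrite binary_ones_half /= odd_double uphalf_double. Qed.

Lemma binary_ones_gt0 (n : nat) : (0 < n)%N -> (0 < binary_ones n)%N.
Proof.
elim/double_ind: n => [//|k k_gt0 IHk _|k _ _].
  by rewrite binary_ones_double IHk.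
by rewrite binary_ones_doubleS.
Qed.

Lemma binary_ones_expM (k n : nat) :
  binary_ones (2 ^ k * n) = binary_ones n.
Proof.
elim: k => [|k IHk]; first by rewrite mul1n.
by rewrite expnS -mulnA mul2n binary_ones_double.
Qed.

(** Appending the digit 0 to [k] keeps the left side and increases the right
    one; appending 1 doubles both sides. *)
Lemma exp_binary_ones_le (n : nat) : (2 ^ binary_ones n <= n.+1)%N.
Proof.
elim/double_ind: n => [|k _ IHk|k IHk].
- by rewrite /binary_ones big_ord0.
- by rewrite binary_ones_double; lia.
- by rewrite binary_ones_doubleS expnS; lia.
Qed.

Lemma exp_binary_ones_eq (n : nat) :
  (2 ^ binary_ones n)%N = n.+1 <-> exists m, n = (2 ^ m - 1)%N.
Proof.
split=> [eq_n|[m ->]].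
  by exists (binary_ones n); lia.
elim: m => [|m IHm]; first by rewrite /binary_ones big_ord0.
have pow_gt0 : (0 < 2 ^ m)%N by rewrite expn_gt0.
have -> : (2 ^ m.+1 - 1 = (2 ^ m - 1).*2.+1)%N by rewrite expnS; lia.
by rewrite binary_ones_doubleS expnS IHm; lia.
Qed.

(** * Plane geometry of the unit circle *)

Section Modulus.
Variable R : realType.
Implicit Types z w : R[i].
Local Notation normc := Normc.normc.

Lemma normc_sqr z : normc z ^+ 2 = complex.Re z ^+ 2 + complex.Im z ^+ 2.
Proof. by case: z => x y /=; rewrite sqr_sqrtr ?addr_ge0 ?sqr_ge0. Qed.

Lemma normc_nneg z : 0 <= normc z.
Proof. by case: z => x y; apply: sqrtr_ge0. Qed.

Lemma normcN z : normc (- z) = normc z.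
Proof. by case: z => x y /=; rewrite !sqrrN. Qed.

Lemma circle_normc_sqr z : normc z ^+ 2 = 1 -> unit_circle z.
Proof.
move=> sqr1; apply/eqP.
by rewrite -(@eqrXn2 _ 2) ?normc_nneg // sqr1 expr1n.
Qed.

Lemma circleN z : unit_circle z -> unit_circle (- z).
Proof. by rewrite /unit_circle /= normcN. Qed.

Lemma circle_sqr z : unit_circle z -> unit_circle (z ^+ 2).
Proof. by rewrite /unit_circle /= expr2 Normc.normcM => ->; rewrite mul1r. Qed.

Lemma circle_sqrt z : unit_circle z -> exists2 w, unit_circle w & w ^+ 2 = z.
Proof.
move=> circ_z; exists (sqrtc z); last exact: sqr_sqrtc.
by apply: circle_normc_sqr; rewrite expr2 -Normc.normcM -expr2 sqr_sqrtc.
Qed.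

Lemma parallelogram z w : unit_circle z -> unit_circle w ->
  normc (z - w) ^+ 2 + normc (z + w) ^+ 2 = 4.
Proof.
move=> circ_z circ_w.
have: normc z ^+ 2 + normc w ^+ 2 = 2.
  by rewrite circ_z circ_w expr1n.
rewrite !normc_sqr; case: z {circ_z} => x y; case: w {circ_w} => u v /=.
by lra.
Qed.

Lemma circle_dist_le2 z w : unit_circle z -> unit_circle w ->
  normc (z - w) <= 2.
Proof.
move=> circ_z circ_w; have := parallelogram circ_z circ_w.
have := sqr_ge0 (normc (z + w)); have := normc_nneg (z - w); nra.
Qed.

Lemma circle_antipodal z w : unit_circle z -> unit_circle w ->
  2 <= normc (z - w) -> z = - w.
Proof.
move=> circ_z circ_w dist_ge2; have := parallelogram circ_z circ_w.
move=> para; apply/eqP; rewrite -addr_eq0; apply/eqP/Normc.eq0_normc/eqP.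
rewrite -sqrf_eq0; apply/eqP.
have := sqr_ge0 (normc (z + w)); nra.
Qed.

Lemma circle_dist_opp z : unit_circle z -> normc (- z - z) = 2.
Proof.
move=> circ_z; have := parallelogram (circleN circ_z) circ_z.
rewrite addNr Normc.normc0 expr0n addr0 => sqr4.
by apply/eqP; rewrite -(@eqrXn2 _ 2) ?normc_nneg // sqr4; apply/eqP; lra.
Qed.

(** The points above the abscissae [1 / (k + 1)] are already infinitely
    many. *)
Lemma circle_infinite (s : seq R[i]) : exists2 z, unit_circle z & z \notin s.
Proof.
pose x (k : nat) : R := k.+1%:R^-1.
pose pt k : R[i] := (x k +i* Num.sqrt (1 - x k ^+ 2))%C.
have circ_pt k : unit_circle (pt k).
  rewrite /unit_circle /= sqr_sqrtr; first by rewrite addrC subrK sqrtr1.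
  by rewrite subr_ge0 expr_le1 ?invr_ge0 // invf_le1 ?ler1n ?ltr0Sn.
have pt_inj : injective pt.
  by move=> j k [/invr_inj/eqP]; rewrite eqr_nat eqSS => /eqP.
apply: contrapT => no_pt.
have: (size (map pt (iota 0 (size s).+1)) <= size s)%N.
  apply: uniq_leq_size; first by rewrite map_inj_uniq ?iota_uniq.
  move=> z /mapP[k _ ->]; apply/negPn/negP => pt_notin.
  by apply: no_pt; exists (pt k).
by rewrite size_map size_iota ltnn.
Qed.

End Modulus.

(** * Nodal polynomials of Leja sequences *)

Section Leja.
Variable R : realType.
Implicit Type a : nat -> R[i].
Local Notation normc := Normc.normc.

Definition nodal_mod a n z : R := \prod_(k < n) normc (z - a k).

Lemma nodal_mod_ge0 a n z : 0 <= nodal_mod a n z.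
Proof. by apply: prodr_ge0 => k _; apply: normc_nneg. Qed.

Lemma nodal_modS a n z :
  nodal_mod a n.+1 z = nodal_mod a n z * normc (z - a n).
Proof. exact: big_ord_recr. Qed.

Lemma leja_max a n z : leja_on_circle a -> unit_circle z ->
  nodal_mod a n z <= nodal_mod a n (a n).
Proof.
case=> _ max_a circ_z; case: n => [|n]; last exact: max_a.
by rewrite /nodal_mod !big_ord0.
Qed.

(** The maximum is positive because a product of finitely many distances
    cannot vanish on the whole circle. *)
Lemma leja_nodal_gt0 a n : leja_on_circle a -> 0 < nodal_mod a n (a n).
Proof.
move=> leja_a.
have [z circ_z z_notin] := circle_infinite (map a (iota 0 n)).
apply: lt_le_trans (leja_max n leja_a circ_z).
apply: prodr_gt0 => k _; rewrite lt_neqAle normc_nneg andbT eq_sym.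
apply/eqP => /Normc.eq0_normc/eqP; rewrite subr_eq0 => /eqP eq_z.
by move/negP: z_notin; apply; rewrite eq_z map_f // mem_iota ltn_ord.
Qed.

Definition square_evens a (k : nat) : R[i] := a k.*2 ^+ 2.

(** Antipodal nodes pair up as [(z - b) (z + b) = z ^ 2 - b ^ 2].  Antipodality
    is assumed only below [n], so that the identity is available inside the
    induction that proves antipodality. *)
Lemma nodal_mod_double a n z :
    (forall k, (k < n)%N -> a k.*2.+1 = - a k.*2) ->
  nodal_mod a n.*2 z = nodal_mod (square_evens a) n (z ^+ 2).
Proof.
elim: n => [|n IHn] anti_a; first by rewrite /nodal_mod !big_ord0.
rewrite doubleS !nodal_modS IHn; last by move=> k lt_kn; apply/anti_a/ltnW.
rewrite anti_a // -mulrA -Normc.normcM; congr (_ * normc _).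
by rewrite /square_evens; ring.
Qed.

(** Comparing the Leja point [a (2k+1)] with the competitor [- a (2k)], at
    which both factors of the product reach their maxima, forces the distance
    of [a (2k+1)] to [a (2k)] to be 2 after cancelling the positive maximum of
    the first factor. *)
Lemma leja_antipodal a k : leja_on_circle a -> a k.*2.+1 = - a k.*2.
Proof.
move=> leja_a; have circ_a := leja_a.1.
elim/ltn_ind: k => k IHk; apply: circle_antipodal => //.
have maxN : nodal_mod a k.*2 (a k.*2) * 2 <=
            nodal_mod a k.*2 (a k.*2.+1) * normc (a k.*2.+1 - a k.*2).
  have := leja_max k.*2.+1 leja_a (circleN (circ_a k.*2)).
  by rewrite !nodal_modS circle_dist_opp // !nodal_mod_double // sqrrN.
rewrite -(ler_pM2l (leja_nodal_gt0 k.*2 leja_a)).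
apply: le_trans maxN _.
by rewrite ler_wpM2r ?normc_nneg ?leja_max.
Qed.

(** Every competitor on the circle is a square [w ^ 2], and at such a point the
    new product is the old product at [w]. *)
Lemma leja_square_evens a : leja_on_circle a ->
  leja_on_circle (square_evens a).
Proof.
move=> leja_a; have circ_a := leja_a.1.
split=> [n|n _ _ /circle_sqrt[w circ_w <-]]; first exact: circle_sqr.
rewrite -!/(nodal_mod _ _ _) {3}/square_evens.
rewrite -!nodal_mod_double ?leja_max // => k _; exact: leja_antipodal.
Qed.

Lemma leja_nodal_max a n : leja_on_circle a ->
  nodal_mod a n (a n) = 2 ^+ binary_ones n.
Proof.
elim/double_ind: n a => [|k _ IHk|k IHk] a leja_a.
- by rewrite /nodal_mod /binary_ones !big_ord0.
- rewrite nodal_mod_double => [|j _]; last exact: leja_antipodal.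
  by rewrite binary_ones_double -(IHk _ (leja_square_evens leja_a)).
- rewrite nodal_modS leja_antipodal // circle_dist_opp; last exact: leja_a.1.
  rewrite nodal_mod_double => [|j _]; last exact: leja_antipodal.
  rewrite sqrrN binary_ones_doubleS [RHS]exprSr.
  by rewrite -(IHk _ (leja_square_evens leja_a)).
Qed.

Lemma normc_leja_poly a n z : normc (leja_poly a n).[z] = nodal_mod a n z.
Proof.
rewrite /leja_poly; elim: n => [|n IHn].
  by rewrite /nodal_mod !big_ord0 hornerC Normc.normc1.
by rewrite big_ord_recr hornerM hornerXsubC Normc.normcM IHn nodal_modS.
Qed.

Lemma leja_circle_norm a n : leja_on_circle a ->
  circle_norm (leja_poly a n) = 2 ^+ binary_ones n.
Proof.
move=> leja_a.
have ub : ubound [set normc (leja_poly a n).[z] | z in @unit_circle R]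
            (2 ^+ binary_ones n).
  by move=> _ [z circ_z <-]; rewrite normc_leja_poly -(leja_nodal_max n leja_a) leja_max.
have attained : [set normc (leja_poly a n).[z] | z in @unit_circle R]
                  (2 ^+ binary_ones n).
  by exists (a n); [exact: leja_a.1|rewrite normc_leja_poly leja_nodal_max].
apply/eqP; rewrite eq_le; apply/andP; split.
  by apply: ge_sup ub; exists (2 ^+ binary_ones n).
by apply: ub_le_sup attained; exists (2 ^+ binary_ones n).
Qed.

(** * The logarithmic ratio *)

Lemma log_ratioE a n : leja_on_circle a ->
  log_ratio a n = ln (2 ^ binary_ones n)%:R / ln n.+1%:R.
Proof. by move=> leja_a; rewrite /log_ratio leja_circle_norm // natrX. Qed.

Lemma ln_nat_gt0 n : (1 < n)%N -> 0 < ln (n%:R : R).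
Proof. by move=> n_gt1; rewrite ln_gt0 ?ltr1n. Qed.

Lemma log_ratio_ge0 a n : leja_on_circle a -> 0 <= log_ratio a n.
Proof.
by move=> leja_a; rewrite log_ratioE // divr_ge0 ?ln_ge0 ?ler1n ?expn_gt0.
Qed.

Lemma log_ratio_gt0 a n : leja_on_circle a -> (0 < n)%N -> 0 < log_ratio a n.
Proof.
move=> leja_a n_gt0; rewrite log_ratioE // divr_gt0 ?ln_nat_gt0 //.
by rewrite -{1}(expn0 2) ltn_exp2l ?binary_ones_gt0.
Qed.

Lemma log_ratio_le1 a n : leja_on_circle a -> (0 < n)%N -> log_ratio a n <= 1.
Proof.
move=> leja_a n_gt0; rewrite log_ratioE // ler_pdivrMr ?ln_nat_gt0 // mul1r.
by rewrite ler_ln ?posrE ?ltr0n ?expn_gt0 // ler_nat exp_binary_ones_le.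
Qed.

Lemma log_ratio_eq1 a n : leja_on_circle a -> (0 < n)%N ->
  log_ratio a n = 1 <-> (2 ^ binary_ones n)%N = n.+1.
Proof.
move=> leja_a n_gt0; have ln_gt0 : 0 < ln (n.+1%:R : R) by exact: ln_nat_gt0.
rewrite log_ratioE //; split=> [/divr1_eq /ln_inj|->].
  by rewrite !posrE !ltr0n expn_gt0 => /(_ isT isT)/eqP; rewrite eqr_nat => /eqP.
by rewrite divff ?gt_eqF.
Qed.

Lemma log_ratio_doubling a k n : leja_on_circle a ->
  log_ratio a (2 ^ k * n) =
    ln (2 ^ binary_ones n)%:R / ln (2 ^ k * n).+1%:R.
Proof. by move=> leja_a; rewrite log_ratioE // binary_ones_expM. Qed.

Lemma log_ratio_doubling_decreasing a n : leja_on_circle a -> (0 < n)%N ->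
  decreasing_seq (fun k : nat => log_ratio a (2 ^ k * n)%N).
Proof.
move=> leja_a n_gt0; apply/decreasing_seqP => k.
have pow_gt0 : (0 < 2 ^ k * n)%N by rewrite muln_gt0 expn_gt0.
have lt_pow : (2 ^ k * n < 2 ^ k.+1 * n)%N by rewrite expnS; lia.
rewrite !log_ratio_doubling // ltr_pM2l; last first.
  by rewrite ln_nat_gt0 // -{1}(expn0 2) ltn_exp2l ?binary_ones_gt0.
rewrite ltf_pV2 ?posrE ?ln_nat_gt0 //; last by lia.
by rewrite ltr_ln ?posrE ?ltr0n // ltr_nat.
Qed.

(** Since [2 ^ (k + 1) <= (2 ^ k * n + 1) ^ 2], the denominator is at least
    [(k + 1) * ln 2 / 2]: the ratio decays like the harmonic sequence. *)
Lemma log_ratio_doubling_le a k n : leja_on_circle a -> (0 < n)%N ->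
  log_ratio a (2 ^ k * n) <= (binary_ones n).*2%:R * harmonic k.
Proof.
move=> leja_a n_gt0; rewrite log_ratio_doubling //.
have pow_gt0 : (0 < 2 ^ k * n)%N by rewrite muln_gt0 expn_gt0.
rewrite ler_pdivrMr ?ln_nat_gt0 // mulrAC ler_pdivlMr ?ltr0Sn //.
rewrite natrX lnXn // -mul2n natrM -[_ *+ _]mulr_natl -!mulrA.
rewrite mulrCA ler_wpM2l // mulr_natr mulr_natl -!lnXn ?ltr0Sn //.
rewrite -!natrX ler_ln ?posrE ?ltr0n ?expn_gt0 // ler_nat.
by rewrite expnS; nia.
Qed.

Lemma log_ratio_doubling_cvg a n : leja_on_circle a -> (0 < n)%N ->
  log_ratio a (2 ^ k * n)%N @[k --> \oo] --> (0 : R).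
Proof.
move=> leja_a n_gt0.
apply: (@squeeze_cvgr _ _ _ _ (fun=> 0)
         (fun k => (binary_ones n).*2%:R * harmonic k)).
- by apply: nearW => k; rewrite log_ratio_ge0 // log_ratio_doubling_le.
- exact: cvg_cst.
- rewrite -[X in _ --> X](mulr0 (binary_ones n).*2%:R).
  by apply: cvgMl_tmp; exact: cvg_harmonic.
Qed.

(** The hypothesis [k <= phi k] puts a tail of the subsequence in every tail of
    [u], so every infimum over a tail of [u] is already 0. *)
Lemma limn_einf_eq0 (u : nat -> R) (phi : nat -> nat) :
    (forall n, 0 <= u n) -> (forall k, (k <= phi k)%N) ->
    u (phi k) @[k --> \oo] --> (0 : R) ->
  limn_einf (fun n => (u n)%:E) = 0%E.
Proof.
move=> u_ge0 phi_ge cvg_u; rewrite limn_einf_lim.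
suff -> : einfs (fun n => (u n)%:E) = cst 0%E by exact: lim_cst.
apply/funext => n; apply/eqP; rewrite eq_le; apply/andP; split; last first.
  by apply: le_ereal_inf_tmp => _ [m _ <-]; rewrite lee_fin.
have cvg_eu : (u (phi k))%:E @[k --> \oo] --> 0%E 
  by apply: cvg_EFin cvg_u; exact: nearW.
rewrite -(cvg_lim _ cvg_eu) //; apply: lime_ge; first exact: cvgP cvg_eu.
exists n => // k /= le_nk; apply: ereal_inf_lbound.
by exists (phi k) => //=; exact: leq_trans le_nk (phi_ge k).
Qed.

End Leja.

Theorem theorem1p1 (R : realType) (a : nat -> R[i]) (ha : leja_on_circle a) :
  [/\ (forall N : nat, (1 <= N)%N ->
         0 < log_ratio a N /\ log_ratio a N <= 1),
      (forall N : nat, (1 <= N)%N ->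
         (log_ratio a N = 1 <->
          exists m : nat, (1 <= m)%N /\ N = (2 ^ m - 1)%N)),
      limn_einf (fun N : nat => (log_ratio a N)%:E) = 0%E &
      (forall N : nat, (1 <= N)%N ->
         decreasing_seq (fun k : nat => log_ratio a (2 ^ k * N)%N) /\
         log_ratio a (2 ^ k * N)%N @[k --> \oo] --> (0 : R))].
Proof.
split=> [N N_gt0|N N_gt0||N N_gt0].
- by split; [exact: log_ratio_gt0|exact: log_ratio_le1].
- rewrite log_ratio_eq1 // exp_binary_ones_eq; split=> [[m def_N]|[m [_ def_N]]].
    by exists m; split=> //; case: m def_N => // def_N; lia.
  by exists m.
(* The powers of two realize the lower limit. *)
- apply: (limn_einf_eq0 (phi := fun k => (2 ^ k * 1)%N)) => [n|k|].
  + exact: log_ratio_ge0.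
  + by rewrite muln1; apply/ltnW/ltn_expl.
  + exact: log_ratio_doubling_cvg.
- split; first exact: log_ratio_doubling_decreasing.
  exact: log_ratio_doubling_cvg.
Qed.
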